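(* Let $\ell$ be a bounded counterfactual loss. The counterfactual risk $P\mapsto R_P(\pi;\ell)$ is identifiable on $\mathcal P$ for every policy $\pi:\mathcal X\to\Delta(\mathcal D)$ if and only if there exist weight functions (bounded measurable functions) $\omega_k:\mathcal D\times\mathcal Y\times\mathcal X\to\mathbb R$, $k\in\mathcal D$, such that $$\ell(d;\boldsymbol y,\boldsymbol x)=\sum_{k\in\mathcal D}\omega_k(d,y_k,\boldsymbol x)\qquad\text{for all } d\in\mathcal D,\ \boldsymbol y\in\mathcal Y^{\mathcal D},\ \boldsymbol x\in\mathcal X.$$ In that case the identification formula is $$R_P(\pi;\ell)=\sum_{d\in\mathcal D}\sum_{k\in\mathcal D}\sum_{y\in\mathcal Y}\mathbb E_{P_{\boldsymbol X}}\left[\omega_k(d,y,\boldsymbol X)\,\pi(d;\boldsymbol X)\,P(Y=y\mid D=k,\boldsymbol X)\right].$$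
   Context: Setup. Let $\mathcal X$ be an arbitrary measurable space, $K,M\ge 2$ integers, $\mathcal D=\{0,\dots,K-1\}$ (decisions), $\mathcal Y=\{0,\dots,M-1\}$ (outcomes). $\Delta(S)$ denotes the set of probability measures on $S$. Potential outcomes are $Y(k)\in\mathcal Y$, $k\in\mathcal D$, with $Y(\mathcal D)=(Y(0),\dots,Y(K-1))\in\mathcal Y^{\mathcal D}$; covariates are $\boldsymbol X\in\mathcal X$; $D\in\mathcal D$ is the observed decision. Given a law $P_{Y(\mathcal D),\boldsymbol X}\in\Delta(\mathcal Y^{\mathcal D}\times\mathcal X)$ and a treatment assignment mechanism (a measurable map $e:\mathcal Y^{\mathcal D}\times\mathcal X\to\Delta(\mathcal D)$, written $e(k;\boldsymbol y,\boldsymbol x)$), the joint law $P=e\cdot P_{Y(\mathcal D),\boldsymbol X}$ of $(D,Y(\mathcal D),\boldsymbol X)$ is $$P(D=k,Y(\mathcal D)=\boldsymbol y,\boldsymbol X\in A)=\int_A e(k;\boldsymbol y,\boldsymbol x)\,P_{Y(\mathcal D)\mid\boldsymbol X}(Y(\mathcal D)=\boldsymbol y\mid\boldsymbol X=\boldsymbol x)\,dP_{\boldsymbol X}(\boldsymbol x)$$ for $A\subseteq\mathcal X$ measurable. Consistency: the observed outcome is $Y=Y(D)$. Strong ignorability of $e$ with respect to $P_{Y(\mathcal D),\boldsymbol X}$: (a) unconfoundedness, $e(d;\boldsymbol y,\boldsymbol x)=e(d;\boldsymbol x)$ for every $d\in\mathcal D$, $P_{Y(\mathcal D),\boldsymbol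 X}$-a.s.; (b) overlap, $e(d;\boldsymbol x)>0$ for every $d\in\mathcal D$, $P_{\boldsymbol X}$-a.s. $\mathcal P$ is the set of all joint laws $P=e\cdot P_{Y(\mathcal D),\boldsymbol X}$ with $P_{Y(\mathcal D),\boldsymbol X}\in\Delta(\mathcal Y^{\mathcal D}\times\mathcal X)$ arbitrary and $e$ strongly ignorable with respect to it. The observed law $Q_P$ of $(D,Y,\boldsymbol X)$ is $Q_P(D=k,Y=y,\boldsymbol X\in A)=P(D=k,Y(k)=y,\boldsymbol X\in A)$. A policy is a (measurable) map $\pi:\mathcal X\to\Delta(\mathcal D)$, written $\pi(d;\boldsymbol x)$. A counterfactual loss is a measurable function $\ell:\mathcal D\times\mathcal Y^{\mathcal D}\times\mathcal X\to\mathbb R$, written $\ell(d;\boldsymbol y,\boldsymbol x)$; it is bounded if $\sup|\ell|<\infty$. The conditional counterfactual risk is $$R_{P_{Y(\mathcal D)\mid\boldsymbol X=\boldsymbol x}}(\pi;\ell)=\sum_{d\in\mathcal D}\sum_{\boldsymbol y\in\mathcal Y^{\mathcal D}}\ell(d;\boldsymbol y,\boldsymbol x)\,\pi(d;\boldsymbol x)\,P(Y(\mathcal D)=\boldsymbol y\mid\boldsymbol X=\boldsymbol x)$$ (defined $P_{\boldsymbol X}$-a.s.) and the counterfactual risk is $R_P(\pi;\ell)=\mathbb E_{P_{\boldsymbol X}}[R_{P_{Y(\mathcal D)\mid\boldsymbol X}}(\pi;\ell)]$. Identifiability. A functional $\theta:\mathcal P\to\mathbb R$ is identifiable if for all $P_1,P_2\in\mathcal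 P$ with $Q_{P_1}=Q_{P_2}$ one has $\theta(P_1)=\theta(P_2)$. *)

(* Defs.v *)
From HB Require Import structures.
From mathcomp Require Import all_boot all_order all_algebra.
From mathcomp Require Import all_classical all_reals all_analysis.

Set Implicit Arguments.
Unset Strict Implicit.
Unset Printing Implicit Defensive.
Import Order.TTheory GRing.Theory Num.Theory.
Import numFieldNormedType.Exports.
Local Open Scope classical_set_scope.
Local Open Scope ring_scope.

(* The library's measurable types are nonempty (pointed), hence the successors;
   only 'I_K.+2 (decisions) and 'I_M.+2 (outcomes) are used below, which covers
   exactly the cases of at least two decisions and two outcomes. *)
HB.instance Definition _ (n : nat) := isPointed.Build 'I_n.+1 ord0.
HB.instance Definition _ (n : nat) :=
  @isMeasurable.Build default_measure_display 'I_n.+1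
    (@discrete_measurable _) (@discrete_measurable0 _)
    (@discrete_measurableC _) (@discrete_measurableU _).

HB.instance Definition _ (n m : nat) :=
  isPointed.Build {ffun 'I_n.+1 -> 'I_m.+1} [ffun=> ord0].
HB.instance Definition _ (n m : nat) :=
  @isMeasurable.Build default_measure_display {ffun 'I_n.+1 -> 'I_m.+1}
    (@discrete_measurable _) (@discrete_measurable0 _)
    (@discrete_measurableC _) (@discrete_measurableU _).

Section conditional_probability.
Context d d' (T : measurableType d) (T' : measurableType d') (R : realType).

(* The subprobability A |-> P({Z in A} /\ E) *)
Definition event_law (P : probability T R) (E : set T)
    (mE : measurable E) (Z : {mfun T >-> T'}) : set T' -> \bar R :=
  pushforward (mrestr P mE) Z.

Section event_law_finite_measure.
Variables (P : probability T R) (E : set T) (mE : measurable E).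
Variable Z : {mfun T >-> T'}.

Let event_law0 : event_law P mE Z set0 = 0%E.
Proof. exact: measure0. Qed.

Let event_law_ge0 A : (0 <= event_law P mE Z A)%E.
Proof. exact: measure_ge0. Qed.

Let event_law_sigma_additive : semi_sigma_additive (event_law P mE Z).
Proof. exact: measure_semi_sigma_additive. Qed.

HB.instance Definition _ := isMeasure.Build _ _ _ (event_law P mE Z)
  event_law0 event_law_ge0 event_law_sigma_additive.

Let event_law_fin_num : fin_num_fun (event_law P mE Z).
Proof.
move=> A mA; rewrite /event_law /pushforward fin_num_measure//.
by rewrite -[_ @^-1` _]setTI; exact: measurable_funPT.
Qed.

HB.instance Definition _ := @Measure_isFinite.Build _ _ _
  (event_law P mE Z) event_law_fin_num.

End event_law_finite_measure.

(* z |-> P(E | Z = z), the Radon-Nikodym derivative of A |-> P({Z in A} /\ E)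
   with respect to the law of Z; it is determined up to a null set of that
   law. *)
Definition cond_prob (P : probability T R) (E : set T) (mE : measurable E)
    (Z : {mfun T >-> T'}) (z : T') : R :=
  fine (Radon_Nikodym (charge_of_finite_measure (event_law P mE Z))
    (distribution P Z) z).

End conditional_probability.

Section counterfactual.
Context d (X : measurableType d) (R : realType) (K M : nat).

Local Notation D := 'I_K.+2.
Local Notation Y := 'I_M.+2.
Local Notation YD := {ffun D -> Y}.

Definition decision (w : D * YD * X) : D := w.1.1.
Definition potential_outcomes (w : D * YD * X) : YD := w.1.2.
Definition covariate (w : D * YD * X) : X := w.2.
(* Consistency: the observed outcome is Y = Y(D). *)
Definition outcome (w : D * YD * X) : Y :=
  potential_outcomes w (decision w).
Definition decision_covariate (w : D * YD * X) : D * X :=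
  (decision w, covariate w).
Definition observation (w : D * YD * X) : D * Y * X :=
  (decision w, outcome w, covariate w).

Lemma measurable_decision : measurable_fun setT decision.
Proof. exact: measurableT_comp. Qed.
HB.instance Definition _ := isMeasurableFun.Build _ _ _ _ decision
  measurable_decision.

Lemma measurable_potential_outcomes : measurable_fun setT potential_outcomes.
Proof. exact: measurableT_comp. Qed.
HB.instance Definition _ := isMeasurableFun.Build _ _ _ _ potential_outcomes
  measurable_potential_outcomes.

Lemma measurable_covariate : measurable_fun setT covariate.
Proof. exact: measurable_snd. Qed.
HB.instance Definition _ := isMeasurableFun.Build _ _ _ _ covariate
  measurable_covariate.

Lemma measurable_outcome : measurable_fun setT outcome.
Proof.
have mev : measurable_fun setT (fun p : D * YD => p.2 p.1).
  move=> _ B _; apply: countable_measurable; last exact: countableP.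
  move=> [k y]; have -> : [set (k, y)] = [set k] `*` [set y].
    by apply/seteqP; split=> -[a b] /= [-> ->].
  exact: measurableX.
exact: (measurableT_comp mev measurable_fst).
Qed.
HB.instance Definition _ := isMeasurableFun.Build _ _ _ _ outcome
  measurable_outcome.

Lemma measurable_decision_covariate : measurable_fun setT decision_covariate.
Proof. exact: measurable_fun_pair. Qed.
HB.instance Definition _ := isMeasurableFun.Build _ _ _ _ decision_covariate
  measurable_decision_covariate.

Lemma measurable_observation : measurable_fun setT observation.
Proof. by do 2?apply: measurable_fun_pair. Qed.
HB.instance Definition _ := isMeasurableFun.Build _ _ _ _ observation
  measurable_observation.

Definition baseline_potential_outcomes (w : YD * X) : YD := w.1.
Definition baseline_covariate (w : YD * X) : X := w.2.

Lemma measurable_baseline_potential_outcomes :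
  measurable_fun setT baseline_potential_outcomes.
Proof. exact: measurable_fst. Qed.

Lemma measurable_baseline_covariate : measurable_fun setT baseline_covariate.
Proof. exact: measurable_snd. Qed.
HB.instance Definition _ := isMeasurableFun.Build _ _ _ _ baseline_covariate
  measurable_baseline_covariate.

Lemma measurable_baseline_event (y : YD) :
  measurable (baseline_potential_outcomes @^-1` [set y]).
Proof.
by rewrite -[_ @^-1` _]setTI; exact: measurable_baseline_potential_outcomes.
Qed.

Lemma measurable_potential_outcomes_event (y : YD) :
  measurable (potential_outcomes @^-1` [set y]).
Proof. by rewrite -[_ @^-1` _]setTI; exact: measurable_potential_outcomes. Qed.

Lemma measurable_outcome_event (y : Y) : measurable (outcome @^-1` [set y]).
Proof. by rewrite -[_ @^-1` _]setTI; exact: measurable_outcome. Qed.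

(* P = e . P0. Here and in same_observed_law, laws are compared on measurable
   sets only: a library measure takes unspecified values on the other sets. *)
Definition is_joint_law (P : probability (D * YD * X)%type R)
    (e : R.-pker (YD * X)%type ~> D) (P0 : probability (YD * X)%type R) :=
  forall (k : D) (y : YD) (A : set X), measurable A ->
    P ([set k] `*` [set y] `*` A) =
    (\int[distribution P0 baseline_covariate]_(x in A)
      (e (y, x) [set k] *
       (cond_prob P0 (measurable_baseline_event y) baseline_covariate x)%:E))%E.

(* e' is the mechanism written e(d; x) once e(d; y, x) does not depend on y. *)
Definition strongly_ignorable (e : R.-pker (YD * X)%type ~> D)
    (P0 : probability (YD * X)%type R) :=
  exists2 e' : R.-pker X ~> D,
    forall k : D, {ae P0, forall w, e w [set k] = e' w.2 [set k]} &
    forall k : D, {ae distribution P0 baseline_covariate,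
                     forall x, (0 < e' x [set k])%E}.

Definition ignorable_laws : set (probability (D * YD * X)%type R) :=
  [set P | exists P0 e, is_joint_law P e P0 /\ strongly_ignorable e P0].

Definition same_observed_law (P1 P2 : probability (D * YD * X)%type R) :=
  forall B : set (D * Y * X), measurable B ->
    distribution P1 observation B = distribution P2 observation B.

Definition identifiable (theta : probability (D * YD * X)%type R -> R) :=
  forall P1 P2, ignorable_laws P1 -> ignorable_laws P2 ->
    same_observed_law P1 P2 -> theta P1 = theta P2.

Definition bounded_loss (l : D -> YD -> X -> R) :=
  let f := fun w : D * YD * X => l w.1.1 w.1.2 w.2 in
  measurable_fun setT f /\ bounded_fun f.

Definition weight_function (w : D -> Y -> X -> R) :=
  let f := fun v : D * Y * X => w v.1.1 v.1.2 v.2 in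
  measurable_fun setT f /\ bounded_fun f.

Definition policy_prob (pi : R.-pker X ~> D) (k : D) (x : X) : R :=
  fine (pi x [set k]).

Definition prob_potential_given (P : probability (D * YD * X)%type R)
    (y : YD) (x : X) : R :=
  cond_prob P (measurable_potential_outcomes_event y) covariate x.

Definition prob_outcome_given (P : probability (D * YD * X)%type R)
    (y : Y) (k : D) (x : X) : R :=
  cond_prob P (measurable_outcome_event y) decision_covariate (k, x).

Definition cond_risk (P : probability (D * YD * X)%type R)
    (pi : R.-pker X ~> D) (l : D -> YD -> X -> R) (x : X) : R :=
  \sum_(k : D) \sum_(y : YD)
    l k y x * policy_prob pi k x * prob_potential_given P y x.

Definition risk (pi : R.-pker X ~> D) (l : D -> YD -> X -> R)
    (P : probability (D * YD * X)%type R) : R :=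
  \int[distribution P covariate]_x cond_risk P pi l x.

End counterfactual.

Arguments decision {d X K M} w.
Arguments potential_outcomes {d X K M} w.
Arguments covariate {d X K M} w.
Arguments outcome {d X K M} w.
Arguments decision_covariate {d X K M} w.
Arguments observation {d X K M} w.
Arguments baseline_potential_outcomes {d X K M} w.
Arguments baseline_covariate {d X K M} w.

(* Main.v *)
Require Import Defs.
From HB Require Import structures.
From mathcomp Require Import all_boot all_order all_algebra.
From mathcomp Require Import all_classical all_reals all_analysis.
From mathcomp Require Import measurable_realfun.

Set Implicit Arguments.
Unset Strict Implicit.
Unset Printing Implicit Defensive.
Import Order.TTheory GRing.Theory Num.Theory.
Import numFieldNormedType.Exports.
Local Open Scope classical_set_scope.
Local Open Scope ring_scope.

(** Why the theorem holds.

    Write p(y|x) for the conditional law of the vector of potential outcomes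
    and e_k(x) for P(D = k | X = x).  Unconfoundedness makes the decision
    independent of the potential outcomes given the covariate, and overlap makes
    e_k positive almost surely, so

      P(Y = c | D = k, X = x) = sum of p(y|x) over the y with y_k = c

    for almost every x ([prob_outcome_given_ignorable]): what is observed in
    arm k is the k-th marginal of p(.|x).  The risk under an additive loss only
    involves these marginals; regrouping the potential outcome vectors by their
    k-th coordinate gives the identification formula ([risk_additive]).
    Sufficiency is then the observation that every ingredient of the formula is
    a function of the observed law ([identifiable_additive]).  Conditional
    probabilities are only defined up to null sets, and those of the law of
    (D, X) have to be turned into null sets of the law of X: this is the second
    use of overlap, through the product rule

      P(E | W = s, Z) P(W = s | Z) = P(E and W = s | Z)   ([cond_prob_pair]).

    For necessity, fix x and compare two laws whose covariate is constantly x
    and whose decision is uniform and independent of the potential outcomes.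
    If the potential outcomes have the same one-dimensional marginals, the two
    observed laws agree, so the constant policy a must have the same risk under
    both ([identifiable_marginals]).  Let N be the number of decisions, y a
    vector of outcomes, 0 the zero vector and z(k) the vector with the same k-th
    coordinate as y and zeros elsewhere.  The uniform distributions on the two
    families

      y, 0, ..., 0 (N - 1 zeros)     and     the z(k), one for each decision k,

    have the same marginals: coordinate k is y_k once and 0 otherwise.  Hence
    l(a; y, x) + (N - 1) l(a; 0, x) = sum over k of l(a; z(k), x), and
    splitting the constant term evenly between the arms yields explicit weights
    ([additive_weight]) that inherit measurability and boundedness from l. *)

(** * Measure-theoretic preliminaries *)

Lemma trivIset_preimage (T : Type) (I : eqType) (f : T -> I) (B : set T) :
  trivIset setT (fun i => B `&` f @^-1` [set i]).
Proof.
apply/trivIsetP => i j _ _ /eqP ij.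
by apply/seteqP; split=> t //= [[_ ->] [_ /ij]].
Qed.

Section measure_preliminaries.
Context d (T : measurableType d) (R : realType).
Implicit Types (mu : {measure set T -> \bar R}).

(** Laws are compared on measurable sets only, which is enough because a
    negligible set is by definition contained in a measurable null set. *)
Lemma ae_eq_measure mu1 mu2 (Q : T -> Prop) :
  (forall A, measurable A -> mu1 A = mu2 A) ->
  {ae mu1, forall x, Q x} -> {ae mu2, forall x, Q x}.
Proof. by move=> mu12 [N [mN N0 QN]]; exists N; split=> //; rewrite -mu12. Qed.

Lemma ae_finite (I : finType) mu (Q : I -> T -> Prop) :
  (forall i, {ae mu, forall x, Q i x}) -> {ae mu, forall x, forall i, Q i x}.
Proof.
move=> Qae; have : \forall x \near almost_everywhere mu,
    forall i, i \in enum I -> Q i x.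
  elim: (enum I) => [|i s IHs]; first by apply: aeW => x i; rewrite in_nil.
  apply: filterS2 (Qae i) IHs => x Qi Qs j; rewrite inE => /orP[/eqP->//|].
  exact: Qs.
by apply: filterS => x Qx i; apply: Qx; rewrite mem_enum.
Qed.

Lemma measure_partition (I : finType) (Q : pred I) mu (F : I -> set T)
    (B : set T) :
  (forall i, measurable (F i)) -> trivIset setT F ->
  \bigcup_(i in [set` Q]) F i = B -> mu B = (\sum_(i | Q i) mu (F i))%E.
Proof.
move=> mF tF <-; have finQ : finite_set [set` Q] by exact: finite_finset.
rewrite (measure_fin_bigcup mu finQ)//.
- rewrite -[RHS]big_filter [RHS]fsbig_seq ?filter_uniq ?index_enum_uniq//.
  apply: eq_fsbigl; apply/seteqP.
  by split=> i /=; rewrite mem_filter mem_index_enum andbT.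
- exact: sub_trivIset tF.
Qed.

Lemma integrable_boundedMl mu (D : set T) (C : R) (h f : T -> R) :
  measurable D -> measurable_fun setT h -> (forall x, `|h x| <= C) ->
  mu.-integrable D (EFin \o f) ->
  mu.-integrable D (fun x => (h x * f x)%:E).
Proof.
move=> mD mh hC; apply: integrableMr => //; first exact: measurable_funTS.
exists C; split=> [|c /ltW Cc x _ /=]; first exact: num_real.
exact: le_trans Cc.
Qed.

Lemma Rintegral_sum (I : finType) mu (f : I -> T -> R) :
  (forall i, mu.-integrable setT (EFin \o f i)) ->
  \int[mu]_x (\sum_i f i x) = \sum_i \int[mu]_x f i x.
Proof.
move=> intf.
have intE i : (\int[mu]_x (f i x)%:E)%E = (\int[mu]_x f i x)%:E.
  by rewrite fineK//; exact: (integrable_fin_num measurableT (intf i)).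
rewrite {1}/Rintegral; under eq_integral do rewrite -sumEFin.
rewrite integral_sum//; under eq_bigr do rewrite intE.
by rewrite sumEFin.
Qed.

Lemma ae_eq_Rintegral mu (f g : T -> R) :
  measurable_fun setT f -> measurable_fun setT g ->
  {ae mu, forall x, f x = g x} -> \int[mu]_x f x = \int[mu]_x g x.
Proof.
move=> mf mg fg; congr fine.
apply: ae_eq_integral => //; [exact/measurable_EFinP|exact/measurable_EFinP|].
by apply: filterS fg => x /= -> _.
Qed.

Lemma measurable_sum_cond (I : finType) (Q : pred I) (f : I -> T -> R) :
  (forall i, measurable_fun setT (f i)) ->
  measurable_fun setT (fun x => \sum_(i | Q i) f i x).
Proof.
by move=> mf; under eq_fun do rewrite -big_filter; exact: measurable_sum.
Qed.

End measure_preliminaries.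

(** * Conditional probabilities *)

Section cond_prob_theory.
Context d d' (T : measurableType d) (T' : measurableType d') (R : realType).
Variables (P : probability T R) (Z : {mfun T >-> T'}).

Section single_event.
Variables (E : set T) (mE : measurable E).

Lemma event_law_dominated : event_law P mE Z `<< distribution P Z.
Proof.
apply/null_content_dominatesP => A mA PA0; apply/eqP.
rewrite eq_le measure_ge0 andbT -PA0 /event_law /pushforward/= /mrestr.
have mZA : measurable (Z @^-1` A).
  by rewrite -[_ @^-1` _]setTI; exact: measurable_funPT.
by apply: le_measure; rewrite ?inE//; exact: measurableI.
Qed.

Lemma EFin_cond_prob z : (cond_prob P mE Z z)%:E =
  Radon_Nikodym (charge_of_finite_measure (event_law P mE Z))
    (distribution P Z) z.
Proof.
by rewrite fineK//; apply: Radon_Nikodym_fin_num; exact: event_law_dominated.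
Qed.

Lemma integrable_cond_prob :
  (distribution P Z).-integrable setT (EFin \o cond_prob P mE Z).
Proof.
have -> : EFin \o cond_prob P mE Z = Radon_Nikodym
    (charge_of_finite_measure (event_law P mE Z)) (distribution P Z).
  by apply/funext => z; rewrite /= EFin_cond_prob.
by apply: Radon_Nikodym_integrable; exact: event_law_dominated.
Qed.

Lemma measurable_cond_prob : measurable_fun setT (cond_prob P mE Z).
Proof. exact/measurable_EFinP/(measurable_int _ integrable_cond_prob). Qed.

Lemma integral_cond_prob A : measurable A ->
  (\int[distribution P Z]_(x in A) (cond_prob P mE Z x)%:E =
   P (Z @^-1` A `&` E))%E.
Proof.
move=> mA; under eq_integral do rewrite EFin_cond_prob.
by rewrite -Radon_Nikodym_integral//; exact: event_law_dominated.
Qed.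

(** Measurability of the candidate suffices: its integrability comes from the
    equality of the integrals. *)
Lemma cond_prob_unique (f : T' -> R) : measurable_fun setT f ->
  (forall A, measurable A ->
    (\int[distribution P Z]_(x in A) (f x)%:E = P (Z @^-1` A `&` E))%E) ->
  {ae distribution P Z, forall x, f x = cond_prob P mE Z x}.
Proof.
move=> mf intf.
have /= : ae_eq (distribution P Z) setT (EFin \o cond_prob P mE Z) (EFin \o f).
  apply: integral_ae_eq => //; first exact: integrable_cond_prob.
    exact/measurable_EFinP.
  by move=> A _ mA; rewrite intf//; exact: integral_cond_prob.
by apply: filterS => x /(_ I) [->].
Qed.

End single_event.

Lemma cond_prob_partition (I : finType) (Q : pred I) (F : I -> set T)
    (mF : forall i, measurable (F i)) (E : set T) (mE : measurable E) :
  trivIset setT F -> \bigcup_(i in [set` Q]) F i = E ->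
  {ae distribution P Z, forall x,
    \sum_(i | Q i) cond_prob P (mF i) Z x = cond_prob P mE Z x}.
Proof.
move=> tF FE; apply: cond_prob_unique.
  by apply: measurable_sum_cond => i; exact: measurable_cond_prob.
move=> A mA; have mZA : measurable (Z @^-1` A).
  by rewrite -[_ @^-1` _]setTI; exact: measurable_funPT.
under eq_integral do rewrite -sumEFin.
rewrite integral_sum//; last first.
  by move=> i; exact: integrableS (integrable_cond_prob (mF i)).
rewrite (@measure_partition _ _ _ _ Q P (fun i => Z @^-1` A `&` F i)).
- by apply: eq_bigr => i _; exact: integral_cond_prob.
- by move=> i; exact: measurableI.
- apply/trivIsetP => i j _ _ ij; rewrite setIACA.
  by move/trivIsetP : tF => ->//; rewrite setI0.
- by rewrite -FE setI_bigcupr.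
Qed.

Lemma cond_prob_setT :
  {ae distribution P Z, forall x, cond_prob P measurableT Z x = 1}.
Proof.
have : {ae distribution P Z, forall x, 1 = cond_prob P measurableT Z x}.
  apply: cond_prob_unique => // A mA.
  by rewrite integral_cst// mul1e setIT.
by apply: filterS => x ->.
Qed.

End cond_prob_theory.

Lemma eq_cond_prob d d' (T : measurableType d) (T' : measurableType d')
    (R : realType) (P1 P2 : probability T R) (Z : {mfun T >-> T'}) (E : set T)
    (mE : measurable E) :
  (forall A, measurable A -> distribution P1 Z A = distribution P2 Z A) ->
  (forall A, measurable A -> P1 (Z @^-1` A `&` E) = P2 (Z @^-1` A `&` E)) ->
  {ae distribution P1 Z, forall x, cond_prob P2 mE Z x = cond_prob P1 mE Z x}.
Proof.
move=> PZ PE; apply: cond_prob_unique => [|A mA].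
  exact: measurable_cond_prob.
rewrite PE// -(integral_cond_prob _ _ mE mA).
by apply: eq_measure_integral => B mB _; exact: PZ.
Qed.

(** The product rule P(E | W = s, Z) P(W = s | Z) = P(E, W = s | Z), where
    V = (W, Z).  The slice of the law of V over s is the image under the
    embedding z |-> (s, z) of the measure A |-> P(Z in A, W = s), whose density
    with respect to the law of Z is P(W = s | Z).  Integrating P(E | V) over
    [set s] x A can therefore be carried out on the space of Z alone.  The first
    factor is only determined up to null sets of the law of V; the slice over s
    of such a set need not be null for the law of Z, but almost everywhere on it
    the second factor vanishes. *)
Lemma cond_prob_pair d d' (T : measurableType d) (T' : measurableType d')
    (R : realType) (P : probability T R) (Z : {mfun T >-> T'})
    dS (S : measurableType dS) (V : {mfun T >-> (S * T')%type})
    (s : S) (E F EF : set T) (mE : measurable E) (mF : measurable F)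
    (mEF : measurable EF) :
  measurable [set s] -> (forall t, (V t).2 = Z t) ->
  F = [set t | (V t).1 = s] -> EF = E `&` F ->
  {ae distribution P Z, forall x, cond_prob P mE V (s, x) *
    cond_prob P mF Z x = cond_prob P mEF Z x}.
Proof.
move=> ms VZ Fdef EFdef.
set g := fun x => cond_prob P mE V (s, x).
have mphi : measurable_fun setT (fun x : T' => (s, x)).
  exact: measurable_fun_pair.
pose phi : {mfun T' >-> (S * T')%type} :=
  HB.pack (fun x : T' => (s, x)) (isMeasurableFun.Build _ _ _ _ _ mphi).
have mg : measurable_fun setT g.
  by apply: (measurableT_comp (measurable_cond_prob P V mE)).
pose nu := event_law P mF Z.
have phiA A : phi @^-1` ([set s] `*` A) = A.
  by apply/seteqP; split=> x/=; [case|].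
have VA A B : measurable B -> B `<=` [set s] `*` A ->
    pushforward nu phi B = distribution P V B.
  move=> mB BA.
  rewrite /nu /event_law /pushforward /distribution /pushforward/= /mrestr.
  congr (P _); rewrite Fdef; apply/seteqP; split=> t /=.
    by move=> [Bt V1]; rewrite (surjective_pairing (V t)) V1 VZ.
  move=> BV; have [/= V1 _] := BA _ BV.
  by rewrite -VZ -[in X in B X]V1 -surjective_pairing.
have intg A : measurable A -> nu.-integrable A (EFin \o g).
  move=> mA; apply/integrableP; split.
    exact/measurable_EFinP/measurable_funTS.
  have msA : measurable ([set s] `*` A) by exact: measurableX.
  have := ge0_integral_pushforward (measurable_funPT phi) nu msA
    (f := fun v => `|(cond_prob P mE V v)%:E|%E).
  rewrite phiA => <-//.
    rewrite (eq_measure_integral (distribution P V)); last first.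
      by move=> B mB BA; exact: VA BA.
    have /integrableP[_] := integrableS measurableT msA (@subsetT _ _)
      (integrable_cond_prob P V mE).
    exact.
  apply: measurable_funTS; apply/measurableT_comp => //.
  exact/measurable_EFinP/measurable_cond_prob.
suff : {ae distribution P Z, forall x,
    g x * cond_prob P mF Z x = cond_prob P mEF Z x} by [].
apply: cond_prob_unique.
  by apply: measurable_funM => //; exact: measurable_cond_prob.
move=> A mA; under eq_integral do rewrite EFinM (EFin_cond_prob P Z mF).
have msA : measurable ([set s] `*` A) by exact: measurableX.
rewrite Radon_Nikodym_change_of_variables//; last 2 first.
  exact: event_law_dominated.
  exact: intg.
transitivity (\int[distribution P V]_(v in [set s] `*` A)
    (cond_prob P mE V v)%:E)%E.
  rewrite [RHS](eq_measure_integral (pushforward nu phi)); last first.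
    by move=> B mB BA; apply/esym; exact: VA BA.
  have mc : measurable_fun setT (EFin \o cond_prob P mE V).
    exact/measurable_EFinP/measurable_cond_prob.
  have ic : nu.-integrable (phi @^-1` ([set s] `*` A))
      ((EFin \o cond_prob P mE V) \o phi) by rewrite phiA; exact: intg.
  by rewrite (integral_pushforward (measurable_funPT phi) mc ic msA) phiA.
rewrite integral_cond_prob// EFdef Fdef; congr (P _).
apply/seteqP; split=> t /=; first by move=> [[V1 V2] Et]; rewrite -VZ.
by move=> [Zt [Et Vt]]; rewrite VZ.
Qed.

(** * Policies and treatment mechanisms *)

(** Stated over an arbitrary covariate space, so that it applies to policies as
    well as to mechanisms, whose argument also contains the potential
    outcomes. *)
Section policy_prob_theory.
Context d (X : measurableType d) (R : realType) (K : nat).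
Variable pi : R.-pker X ~> 'I_K.+2.

Lemma EFin_policy_prob k x : (policy_prob pi k x)%:E = pi x [set k].
Proof.
rewrite fineK// ge0_fin_numE//; apply: (@le_lt_trans _ _ 1%E); last exact: ltry.
by rewrite -(prob_kernel (s := pi) x); apply: le_measure; rewrite ?inE.
Qed.

Lemma policy_prob_ge0 k x : 0 <= policy_prob pi k x.
Proof. exact: fine_ge0. Qed.

Lemma policy_prob_le1 k x : policy_prob pi k x <= 1.
Proof.
rewrite -lee_fin EFin_policy_prob -(prob_kernel (s := pi) x).
by apply: le_measure; rewrite ?inE.
Qed.

Lemma measurable_policy_prob k : measurable_fun setT (policy_prob pi k).
Proof.
apply/measurable_EFinP.
have -> : EFin \o policy_prob pi k = fun x => pi x [set k].
  by apply/funext => x; exact: EFin_policy_prob.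
exact: measurable_kernel.
Qed.

Lemma sum_policy_prob x : \sum_k policy_prob pi k x = 1.
Proof.
apply: EFin_inj; rewrite -sumEFin -(prob_kernel (s := pi) x).
rewrite (@measure_partition _ _ _ _ xpredT (pi x) (fun k => [set k]))//.
- by apply: eq_bigr => k _; exact: EFin_policy_prob.
- by apply/trivIsetP => i j _ _ /eqP ij; apply/seteqP; split=> k //= [-> /ij].
- by apply/seteqP; split=> // k _; exists k.
Qed.

Lemma normr_policy_prob_le1 k x : `|policy_prob pi k x| <= 1.
Proof. by rewrite ger0_norm ?policy_prob_ge0// policy_prob_le1. Qed.

End policy_prob_theory.

(** * Laws generated by an ignorable mechanism *)

Section joint_law.
Context d (X : measurableType d) (R : realType) (K M : nat).
Local Notation D := 'I_K.+2.
Local Notation Y := 'I_M.+2.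
Local Notation YD := {ffun D -> Y}.

Lemma measurable_decision_event (k : D) :
  measurable ((decision : D * YD * X -> D) @^-1` [set k]).
Proof. by rewrite -[_ @^-1` _]setTI; exact: measurable_decision. Qed.

Variables (P : probability (D * YD * X)%type R).
Variable e : R.-pker (YD * X)%type ~> D.
Variable P0 : probability (YD * X)%type R.
Hypothesis hP : is_joint_law P e P0.

Let q (y : YD) : X -> R :=
  cond_prob P0 (measurable_baseline_event y) baseline_covariate.
Let mu0 := distribution P0 baseline_covariate.

Lemma joint_law_policy k y A : measurable A ->
  (P ([set k] `*` [set y] `*` A) =
   \int[distribution P0 baseline_covariate]_(x in A)
    (policy_prob e k (y, x) *
     cond_prob P0 (measurable_baseline_event y) baseline_covariate x)%:E)%E.
Proof.
move=> mA; rewrite hP//; apply: eq_integral => x _.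
by rewrite EFinM EFin_policy_prob.
Qed.

Lemma measurable_mechanism k (y : YD) :
  measurable_fun setT (fun x : X => policy_prob e k (y, x)).
Proof.
apply: (measurableT_comp (measurable_policy_prob e k)).
exact: measurable_fun_pair.
Qed.

(** Summing over the decisions, whose probabilities add up to one, removes the
    mechanism. *)
Lemma joint_law_potential_outcomes y A : measurable A ->
  (P (covariate @^-1` A `&` potential_outcomes @^-1` [set y]) =
   \int[distribution P0 baseline_covariate]_(x in A)
     (cond_prob P0 (measurable_baseline_event y) baseline_covariate x)%:E)%E.
Proof.
move=> mA.
rewrite (@measure_partition _ _ _ _ xpredT P
  (fun k : D => [set k] `*` [set y] `*` A)).
- transitivity (\sum_(k < K.+2) \int[mu0]_(x in A)
      (policy_prob e k (y, x) * q y x)%:E)%E.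
    by apply: eq_bigr => k _; exact: joint_law_policy.
  rewrite -integral_sum//; last first.
    move=> k; apply: (@integrable_boundedMl _ _ _ _ _ 1) => //.
    + exact: measurable_mechanism.
    + by move=> x; exact: normr_policy_prob_le1.
    + by apply: (integrableS measurableT) => //; exact: integrable_cond_prob.
  apply: eq_integral => x _.
  by rewrite sumEFin -mulr_suml sum_policy_prob mul1r.
- by move=> k; apply: measurableX => //; exact: measurableX.
- apply/trivIsetP => i j _ _ /eqP ij; apply/seteqP; split=> w //=.
  by move=> [[[-> _] _] [[/ij]]].
- apply/seteqP; split=> -[[k y'] x] /=; first by move=> [? _ [[_ /= ->]]].
  by move=> [Ax yy]; exists k.
Qed.

Lemma joint_law_covariate A : measurable A ->
  distribution P0 baseline_covariate A = distribution P covariate A.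
Proof.
move=> mA.
transitivity (\sum_(y : YD)
    P (covariate @^-1` A `&` potential_outcomes @^-1` [set y]))%E.
  under eq_bigr do rewrite joint_law_potential_outcomes// integral_cond_prob//.
  apply: (@measure_partition _ _ _ _ xpredT P0 (fun y : YD =>
    baseline_covariate @^-1` A `&` baseline_potential_outcomes @^-1` [set y])).
  - move=> y; apply: measurableI; last exact: measurable_baseline_event.
    by rewrite -[_ @^-1` _]setTI; exact: measurable_baseline_covariate.
  - exact: trivIset_preimage.
  - by apply/seteqP; split=> [w [y _ []]//|w Aw]; exists w.1.
apply/esym; apply: (@measure_partition _ _ _ _ xpredT P (fun y : YD =>
  covariate @^-1` A `&` potential_outcomes @^-1` [set y])).
- move=> y; apply: measurableI; last exact: measurable_potential_outcomes_event.
  by rewrite -[_ @^-1` _]setTI; exact: measurable_covariate.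
- exact: trivIset_preimage.
- by apply/seteqP; split=> [w [y _ []]//|w Aw]; exists w.1.2.
Qed.

Lemma prob_potential_given_joint_law y :
  {ae distribution P covariate, forall x,
    cond_prob P0 (measurable_baseline_event y) baseline_covariate x =
    prob_potential_given P y x}.
Proof.
apply: cond_prob_unique; first exact: measurable_cond_prob.
move=> A mA; rewrite joint_law_potential_outcomes//.
apply: eq_measure_integral => B mB _; apply/esym; exact: joint_law_covariate.
Qed.

Variable e' : R.-pker X ~> D.
Hypothesis e'_ae : forall k, {ae P0, forall w, e w [set k] = e' w.2 [set k]}.

(** Unconfoundedness holds off a null set N of the law of the potential outcomes
    and the covariate.  On the section of N at y the identity need not hold for
    the mechanisms, but there the conditional probability of y vanishes almost
    everywhere, because its integral over any part of the section is bounded by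
    the mass of N. *)
Lemma unconfounded_density k y :
  {ae distribution P0 baseline_covariate, forall x,
    policy_prob e k (y, x) *
    cond_prob P0 (measurable_baseline_event y) baseline_covariate x =
    policy_prob e' k x *
    cond_prob P0 (measurable_baseline_event y) baseline_covariate x}.
Proof.
have [N [mN N0 eN]] := e'_ae k.
pose B := xsection N y.
have mB : measurable B by exact: measurable_xsection.
have : ae_eq mu0 B (EFin \o q y) (cst 0%E).
  apply: integral_ae_eq => //.
    by apply: (integrableS measurableT) => //; exact: integrable_cond_prob.
  move=> A AB mA; rewrite integral0 integral_cond_prob//.
  apply: (subset_measure0 _ mN _ N0).
    apply: measurableI; last exact: measurable_baseline_event.
    by rewrite -[_ @^-1` _]setTI; exact: measurable_baseline_covariate.
  by move=> [z x] /= [Ax zy]; have := AB _ Ax; rewrite /B /xsection/= inE -zy.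
apply: filterS => x Bx.
have [yN|yN] := pselect (N (y, x)).
  have [q0] : (q y x)%:E = 0%E by apply: Bx; rewrite /B /xsection/= inE.
  by rewrite -/(q y x) q0 !mulr0.
congr (_ * _); rewrite /policy_prob; congr fine.
by apply: contrapT => ne; apply: yN; apply: eN.
Qed.

Lemma cond_prob_decision_potential_outcomes k y :
  {ae distribution P covariate, forall x,
    policy_prob e' k x * prob_potential_given P y x =
    cond_prob P (measurableI _ _ (measurable_decision_event k)
      (measurable_potential_outcomes_event y)) covariate x}.
Proof.
have : {ae distribution P covariate, forall x, policy_prob e' k x * q y x =
    cond_prob P (measurableI _ _ (measurable_decision_event k)
      (measurable_potential_outcomes_event y)) covariate x}.
  apply: cond_prob_unique.
    apply: measurable_funM; first exact: measurable_policy_prob.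
    exact: measurable_cond_prob.
  move=> A mA.
  transitivity (\int[mu0]_(x in A) (policy_prob e' k x * q y x)%:E)%E.
    apply: eq_measure_integral => B mB _.
    by apply/esym; exact: joint_law_covariate.
  transitivity (\int[mu0]_(x in A) (policy_prob e k (y, x) * q y x)%:E)%E.
    apply: ae_eq_integral => //.
    - apply/measurable_EFinP/measurable_funTS/measurable_funM.
        exact: measurable_policy_prob.
      exact: measurable_cond_prob.
    - apply/measurable_EFinP/measurable_funTS/measurable_funM.
        exact: measurable_mechanism.
      exact: measurable_cond_prob.
    - by apply: filterS (unconfounded_density k y) => x /= -> _.
  rewrite -joint_law_policy//; congr (P _).
  by apply/seteqP; split=> w; [move=> [[]]|move=> [? []]].
by apply: filterS2 (prob_potential_given_joint_law y) => x <-.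
Qed.

Lemma sum_prob_potential_given :
  {ae distribution P covariate, forall x,
    \sum_(y : YD) prob_potential_given P y x = 1}.
Proof.
have tF : trivIset setT
    (fun y : YD => (potential_outcomes : D * YD * X -> YD) @^-1` [set y]).
  by apply/trivIsetP => i j _ _ /eqP ij; apply/seteqP; split=> w //= [-> /ij].
have FT : \bigcup_(y in [set` xpredT])
    (potential_outcomes : D * YD * X -> YD) @^-1` [set y] = setT.
  by apply/seteqP; split=> // w _; exists (potential_outcomes w).
have sumE := cond_prob_partition P covariate
  (fun y : YD => measurable_potential_outcomes_event y) measurableT tF FT.
by apply: filterS2 sumE (cond_prob_setT P covariate) => x <-.
Qed.

(** Identifies the mechanism e(k; x) with P(D = k | X = x): sum
    [cond_prob_decision_potential_outcomes] over all potential outcome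
    vectors. *)
Lemma cond_prob_decision k :
  {ae distribution P covariate, forall x, policy_prob e' k x =
    cond_prob P (measurable_decision_event k) covariate x}.
Proof.
have FD : \bigcup_(y in [set` xpredT])
    ((decision : D * YD * X -> D) @^-1` [set k] `&`
     potential_outcomes @^-1` [set y]) = decision @^-1` [set k].
  by apply/seteqP; split=> [w [y _ []]//|w kw]; exists (potential_outcomes w).
have sumE := cond_prob_partition P covariate
  (fun y : YD => measurableI _ _ (measurable_decision_event k)
      (measurable_potential_outcomes_event y)) (measurable_decision_event k)
  (@trivIset_preimage _ YD potential_outcomes _) FD.
have prodE := ae_finite
  (fun y : YD => cond_prob_decision_potential_outcomes k y).
near=> x.
have sumEx : \sum_(y : YD) cond_prob P
    (measurableI _ _ (measurable_decision_event k)
      (measurable_potential_outcomes_event y)) covariate x =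
    cond_prob P (measurable_decision_event k) covariate x.
  by near: x.
rewrite -sumEx -[LHS]mulr1.
have <- : \sum_(y : YD) prob_potential_given P y x = 1.
  by near: x; exact: sum_prob_potential_given.
rewrite mulr_sumr; apply: eq_bigr => y _.
by move: y; near: x.
Unshelve. all: by end_near. Qed.

End joint_law.

(** * Identification under strong ignorability *)

Section ignorable_law.
Context d (X : measurableType d) (R : realType) (K M : nat).
Local Notation D := 'I_K.+2.
Local Notation Y := 'I_M.+2.
Local Notation YD := {ffun D -> Y}.
Implicit Types P : probability (D * YD * X)%type R.

Lemma ignorable_cond_indep P k y : ignorable_laws P ->
  {ae distribution P covariate, forall x,
    cond_prob P (measurable_decision_event k) covariate x *
    prob_potential_given P y x =
    cond_prob P (measurableI _ _ (measurable_decision_event k)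
      (measurable_potential_outcomes_event y)) covariate x}.
Proof.
move=> [P0 [e [hP [e' e'_ae _]]]].
by apply: filterS2 (cond_prob_decision hP e'_ae k)
  (cond_prob_decision_potential_outcomes hP e'_ae k y) => x ->.
Qed.

Lemma ignorable_overlap P k : ignorable_laws P ->
  {ae distribution P covariate, forall x,
    0 < cond_prob P (measurable_decision_event k) covariate x}.
Proof.
move=> [P0 [e [hP [e' e'_ae e'_gt0]]]].
have e'k := ae_eq_measure (joint_law_covariate hP) (e'_gt0 k).
apply: filterS2 e'k (cond_prob_decision hP e'_ae k) => x e'k <-.
by rewrite -lte_fin EFin_policy_prob.
Qed.

Local Notation measurable_arm_event k y := (measurableI _ _
  (measurable_outcome_event y) (measurable_decision_event k)).

Lemma prob_outcome_given_mul P k y :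
  {ae distribution P covariate, forall x, prob_outcome_given P y k x *
    cond_prob P (measurable_decision_event k) covariate x =
    cond_prob P (measurable_arm_event k y) covariate x}.
Proof.
have pairE := @cond_prob_pair _ _ _ _ _ P covariate _ D decision_covariate k
  _ _ _ (measurable_outcome_event y) (measurable_decision_event k).
by have armE := pairE _ (measurable_arm_event k y); exact: armE.
Qed.

(** In arm k the observed outcome is the k-th potential outcome, so the product
    rule and conditional independence give
    P(Y = y | D = k, X) e_k(X) = e_k(X) P(Y(k) = y | X), where e_k(X) stands for
    P(D = k | X); overlap allows the division by e_k(X). *)
Lemma prob_outcome_given_ignorable P k y : ignorable_laws P ->
  {ae distribution P covariate, forall x, prob_outcome_given P y k x =
    \sum_(z : YD | z k == y) prob_potential_given P z x}.
Proof.
move=> hP.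
have FE : \bigcup_(z in [set` [pred z : YD | z k == y]])
    ((decision : D * YD * X -> D) @^-1` [set k] `&`
     potential_outcomes @^-1` [set z]) =
    outcome @^-1` [set y] `&` decision @^-1` [set k].
  apply/seteqP; split=> [w [z /eqP zk [/= wk wz]]|w [/= wy wk]].
    by split=> //=; rewrite /outcome wk wz.
  exists (potential_outcomes w) => //.
  by apply/eqP; rewrite -wy -wk.
have sumE := cond_prob_partition P covariate
  (fun z : YD => measurableI _ _ (measurable_decision_event k)
      (measurable_potential_outcomes_event z)) (measurable_arm_event k y)
  (@trivIset_preimage _ YD potential_outcomes _) FE.
have indepE := ae_finite (fun z : YD => ignorable_cond_indep k z hP).
near=> x.
have ck : 0 < cond_prob P (measurable_decision_event k) covariate x.
  by near: x; exact: ignorable_overlap.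
apply: (mulIf (lt0r_neq0 ck)).
transitivity (cond_prob P (measurable_arm_event k y) covariate x).
  by near: x; exact: prob_outcome_given_mul.
transitivity (\sum_(z : YD | z k == y) cond_prob P
  (measurableI _ _ (measurable_decision_event k)
      (measurable_potential_outcomes_event z)) covariate x).
  by apply/esym; near: x.
rewrite mulr_suml; apply: eq_bigr => z _; rewrite mulrC; apply/esym.
by move: z; near: x.
Unshelve. all: by end_near. Qed.

Lemma weight_function_section (w : D -> Y -> X -> R) : weight_function w ->
  forall a y,
    measurable_fun setT (w a y) /\ exists C, forall x, `|w a y x| <= C.
Proof.
move=> [mw [C [_ wC]]] a y; split; last first.
  exists (C + 1) => x; apply: (wC (C + 1) _ (a, y, x)) => //.
  by rewrite ltrDl.
have mx : measurable_fun setT (fun x : X => (a, y, x)).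
  exact: measurable_fun_pair.
exact: (measurableT_comp mw mx).
Qed.

Lemma measurable_prob_outcome_given P k y :
  measurable_fun setT (prob_outcome_given P y k).
Proof.
apply: (measurableT_comp (measurable_cond_prob P decision_covariate _)).
exact: measurable_fun_pair.
Qed.

Section additive_loss.
Variables (l : D -> YD -> X -> R) (w : D -> D -> Y -> X -> R).
Hypothesis hw : forall k, weight_function (w k).
Hypothesis lw : forall a y x, l a y x = \sum_k w k a (y k) x.
Variables (pi : R.-pker X ~> D).

(** Potential outcome vectors are grouped according to their k-th coordinate,
    the only one on which the k-th weight depends. *)
Lemma cond_risk_additive P x :
  cond_risk P pi l x = \sum_a \sum_k \sum_(y : Y) w k a y x *
    policy_prob pi a x * \sum_(z : YD | z k == y) prob_potential_given P z x.
Proof.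
rewrite /cond_risk; apply: eq_bigr => a _.
under eq_bigr do rewrite lw !mulr_suml.
rewrite exchange_big/=; apply: eq_bigr => k _.
rewrite (partition_big (fun z : YD => z k) xpredT)//=; apply: eq_bigr => y _.
by rewrite mulr_sumr; apply: eq_bigr => z /eqP ->.
Qed.

(** As a derivative with respect to the law of (D, X), P(Y = y | D = k, X) need
    not be integrable for the law of X; under ignorability it agrees almost
    everywhere with a finite sum of integrable functions. *)
Lemma integrable_weighted_prob_outcome_given P k y a : ignorable_laws P ->
  (distribution P covariate).-integrable setT (EFin \o
    (fun x => w k a y x * policy_prob pi a x * prob_outcome_given P y k x)).
Proof.
move=> hP.
have [mw [C wC]] := weight_function_section (hw k) a y.
have mo := measurable_prob_outcome_given P k y.
have io : (distribution P covariate).-integrable setT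
    (EFin \o prob_outcome_given P y k).
  apply/integrableP; split; first exact/measurable_EFinP.
  have h := prob_outcome_given_ignorable k y hP.
  have /integrableP[mI] : (distribution P covariate).-integrable setT
      (fun x => \sum_(z : YD | z k == y) (prob_potential_given P z x)%:E)%E.
    by apply: integrable_sum => // z _; exact: integrable_cond_prob.
  rewrite (ae_eq_integral (fun x => `|(prob_outcome_given P y k x)%:E|)%E)//.
  - exact: measurableT_comp.
  - by apply: measurableT_comp => //; exact/measurable_EFinP.
  - by apply: filterS h => x /= -> _; rewrite sumEFin.
apply: (@integrable_boundedMl _ _ _ _ _ C) => //.
- by apply: measurable_funM => //; exact: measurable_policy_prob.
- move=> x; rewrite normrM -[leRHS]mulr1; apply: ler_pM => //.
  exact: normr_policy_prob_le1.
Qed.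

Lemma risk_additive P : ignorable_laws P ->
  risk pi l P = \sum_(a < K.+2) \sum_(k < K.+2) \sum_(y < M.+2)
    \int[distribution P covariate]_x
      (w k a y x * policy_prob pi a x * prob_outcome_given P y k x).
Proof.
move=> hP; pose mu := distribution P covariate.
have mw k a y : measurable_fun setT (w k a y).
  exact: (weight_function_section (hw k) a y).1.
transitivity (\int[mu]_x \sum_(i : D * D * Y) (w i.1.2 i.1.1 i.2 x *
    policy_prob pi i.1.1 x * prob_outcome_given P i.2 i.1.2 x)).
  apply: ae_eq_Rintegral.
    rewrite (funext (cond_risk_additive P)).
    do 3 (apply: measurable_sum => ?).
    apply: measurable_funM.
      by apply: measurable_funM => //; exact: measurable_policy_prob.
    by apply: measurable_sum_cond => z; exact: measurable_cond_prob.
  - apply: measurable_sum_cond => i; apply: measurable_funM.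
      by apply: measurable_funM => //; exact: measurable_policy_prob.
    exact: measurable_prob_outcome_given.
  - have pogE := ae_finite (fun k => ae_finite (fun y =>
      prob_outcome_given_ignorable k y hP)).
    apply: filterS pogE => x pogE; rewrite cond_risk_additive !pair_bigA.
    by apply: eq_bigr => -[[a k] y] _ /=; rewrite pogE.
rewrite Rintegral_sum ?pair_bigA//= => -[[a k] y] /=.
exact: integrable_weighted_prob_outcome_given.
Qed.

End additive_loss.

Section observed_law.
Variables P1 P2 : probability (D * YD * X)%type R.
Hypotheses (hP1 : ignorable_laws P1) (hP2 : ignorable_laws P2).
Hypothesis obs12 : same_observed_law P1 P2.

Lemma same_covariate_law A : measurable A ->
  distribution P1 covariate A = distribution P2 covariate A.
Proof.
move=> mA; rewrite /distribution /pushforward/=.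
have -> : covariate @^-1` A =
    (observation : D * YD * X -> _) @^-1` ([set: D * Y] `*` A).
  by apply/seteqP; split=> w //= [].
by apply: obs12; exact: measurableX.
Qed.

(** P(Y = y | D = k, X) is the quotient of P(D = k, Y = y | X) by P(D = k | X).
    Both are determined, up to null sets of the law of X, by the observed law,
    and the denominator is positive by overlap. *)
Lemma same_prob_outcome_given k y :
  {ae distribution P1 covariate, forall x,
    prob_outcome_given P1 y k x = prob_outcome_given P2 y k x}.
Proof.
have covE A : measurable A -> covariate @^-1` A `&` decision @^-1` [set k] =
    (observation : D * YD * X -> _) @^-1` ([set k] `*` [set: Y] `*` A).
  by move=> _; apply/seteqP; split=> w /=; tauto.
have armE A : measurable A ->
    covariate @^-1` A `&` (outcome @^-1` [set y] `&` decision @^-1` [set k]) =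
    (observation : D * YD * X -> _) @^-1` ([set k] `*` [set y] `*` A).
  by move=> _; apply/seteqP; split=> w /=; tauto.
have c12 : {ae distribution P1 covariate, forall x,
    cond_prob P2 (measurable_decision_event k) covariate x =
    cond_prob P1 (measurable_decision_event k) covariate x}.
  apply: eq_cond_prob => A mA; first exact: same_covariate_law.
  rewrite covE//; apply: obs12.
  by apply: measurableX => //; exact: measurableX.
have a12 : {ae distribution P1 covariate, forall x,
    cond_prob P2 (measurable_arm_event k y) covariate x =
    cond_prob P1 (measurable_arm_event k y) covariate x}.
  apply: eq_cond_prob => A mA; first exact: same_covariate_law.
  rewrite armE//; apply: obs12.
  by apply: measurableX => //; exact: measurableX.
have mul2 : {ae distribution P1 covariate, forall x,
    prob_outcome_given P2 y k x *
    cond_prob P2 (measurable_decision_event k) covariate x =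
    cond_prob P2 (measurable_arm_event k y) covariate x}.
  apply: ae_eq_measure (prob_outcome_given_mul P2 k y) => A mA.
  exact/esym/same_covariate_law.
near=> x.
have ck : 0 < cond_prob P1 (measurable_decision_event k) covariate x.
  by near: x; exact: ignorable_overlap.
apply: (mulIf (lt0r_neq0 ck)).
have -> : prob_outcome_given P1 y k x *
    cond_prob P1 (measurable_decision_event k) covariate x =
    cond_prob P1 (measurable_arm_event k y) covariate x.
  by near: x; exact: prob_outcome_given_mul.
have <- : cond_prob P2 (measurable_decision_event k) covariate x =
    cond_prob P1 (measurable_decision_event k) covariate x by near: x.
have -> : prob_outcome_given P2 y k x *
    cond_prob P2 (measurable_decision_event k) covariate x =
    cond_prob P2 (measurable_arm_event k y) covariate x by near: x.
by apply/esym; near: x.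
Unshelve. all: by end_near. Qed.

End observed_law.

Lemma identifiable_additive (l : D -> YD -> X -> R) (w : D -> D -> Y -> X -> R)
    (pi : R.-pker X ~> D) :
  (forall k, weight_function (w k)) ->
  (forall a y x, l a y x = \sum_k w k a (y k) x) ->
  identifiable (risk pi l).
Proof.
move=> hw lw P1 P2 hP1 hP2 obs12.
rewrite (risk_additive hw lw pi hP1) (risk_additive hw lw pi hP2).
apply: eq_bigr => a _; apply: eq_bigr => k _; apply: eq_bigr => y _.
have mw : measurable_fun setT (fun x => w k a y x * policy_prob pi a x).
  apply: measurable_funM; last exact: measurable_policy_prob.
  exact: (weight_function_section (hw k) a y).1.
transitivity (\int[distribution P1 covariate]_x
    (w k a y x * policy_prob pi a x * prob_outcome_given P2 y k x)).
  apply: ae_eq_Rintegral.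
  - by apply: measurable_funM => //; exact: measurable_prob_outcome_given.
  - by apply: measurable_funM => //; exact: measurable_prob_outcome_given.
  - by apply: filterS (same_prob_outcome_given hP1 obs12 k y) => x ->.
congr fine; apply: eq_measure_integral => A mA _.
exact: (same_covariate_law obs12 mA).
Qed.

End ignorable_law.

(** * Finitely supported laws with a constant covariate *)

Section empirical.
Context d (T : measurableType d) (R : realType) (I : finType) (i0 : I).
Variable g : I -> T.

(** The uniform distribution on the family g, repetitions counted.  Indexing the
    summands by position in [enum I] presents it as a finite sum of measures;
    the point i0 witnesses that I is nonempty and is the default value of
    [nth], never reached. *)
Definition empirical : set T -> \bar R :=
  mscale (#|I|%:R^-1)%:nng
    (msum (fun n => \d_(g (nth i0 (enum I) n))) #|I|).

HB.instance Definition _ := Measure.on empirical.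

Lemma empiricalE A :
  empirical A = (#|I|%:R^-1 * \sum_i \1_A (g i))%:E.
Proof.
rewrite /empirical /mscale/= /msum EFinM; congr (_ * _)%E.
rewrite -sumEFin -[RHS]big_enum [RHS](big_nth i0) big_mkord -cardE.
by apply: eq_bigr.
Qed.

Lemma empirical_constant (A : set T) (b : R) :
  (forall i, \1_A (g i) = b) -> empirical A = b%:E.
Proof.
move=> gb; rewrite empiricalE; under eq_bigr do rewrite gb.
rewrite sumr_const -[b *+ _]mulr_natl mulKf// pnatr_eq0 -lt0n.
by apply/card_gt0P; exists i0.
Qed.

Lemma empirical_setT : empirical setT = 1%E.
Proof. by apply: empirical_constant => i; rewrite indicT. Qed.

HB.instance Definition _ :=
  Measure_isProbability.Build _ _ _ empirical empirical_setT.

End empirical.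

(** When Z is constantly x, conditional probabilities given Z = x are determined
    at the point x itself, even if the singleton of x is not measurable. *)
Section point_covariate.
Context d d' (T : measurableType d) (T' : measurableType d') (R : realType).
Variables (P : probability T R) (Z : {mfun T >-> T'}) (x : T').
Hypothesis Zx : forall A, measurable A -> distribution P Z A = \d_x A.

Lemma integral_point_covariate (A : set T') (f : T' -> R) : measurable A ->
  measurable_fun setT f ->
  (\int[distribution P Z]_(z in A) (f z)%:E = \d_x A * (f x)%:E)%E.
Proof.
move=> mA mf; rewrite (eq_measure_integral \d_x); last first.
  by move=> B mB _; exact: Zx.
by rewrite integral_dirac//; exact/measurable_EFinP/measurable_funTS.
Qed.

Lemma cond_prob_point_covariate E (mE : measurable E) :
  (cond_prob P mE Z x)%:E = P E.
Proof.
have := integral_cond_prob P Z mE measurableT.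
rewrite integral_point_covariate//; last exact: measurable_cond_prob.
by rewrite diracT mul1e preimage_setT setTI.
Qed.

End point_covariate.

Section constant_kernel.
Context d d' (X : measurableType d) (Y : measurableType d') (R : realType).

Definition constant_kernel (U : pprobability Y R) : R.-pker X ~> Y :=
  kprobability (measurable_cst U).

Lemma constant_kernelE U x A : constant_kernel U x A = U A.
Proof. by []. Qed.

End constant_kernel.

Section randomized_law.
Context d (X : measurableType d) (R : realType) (K M : nat).
Local Notation D := 'I_K.+2.
Local Notation Y := 'I_M.+2.
Local Notation YD := {ffun D -> Y}.
Variables (J : finType) (j0 : J).

Definition uniform_decision : pprobability D R :=
  empirical R ord0 (id : D -> D).

Lemma uniform_decisionE (k : D) : uniform_decision [set k] = (K.+2%:R^-1)%:E.
Proof.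
rewrite [LHS]empiricalE card_ord (bigD1 k)//= big1 ?addr0.
  by rewrite indicE mem_set// mulr1.
by move=> j /eqP jk; rewrite indicE memNset.
Qed.

Definition baseline_law (f : J -> YD) (x : X) : probability (YD * X)%type R :=
  empirical R j0 (fun j => (f j, x)).

(** A randomized experiment on the covariate value x: the decision is uniform
    and independent of the potential outcomes, which are uniform on the family
    f. *)
Definition randomized_law (f : J -> YD) (x : X) :
    probability (D * YD * X)%type R :=
  empirical R (ord0, j0) (fun kj : D * J => (kj.1, f kj.2, x)).

Lemma baseline_lawE f x A :
  baseline_law f x A = (#|J|%:R^-1 * \sum_j \1_A (f j, x))%:E.
Proof. exact: empiricalE. Qed.

Lemma randomized_lawE f x A : randomized_law f x A =
  ((K.+2%:R^-1 * #|J|%:R^-1) * \sum_k \sum_j \1_A (k, f j, x))%:E.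
Proof.
rewrite [LHS]empiricalE card_prod card_ord natrM invfM.
by rewrite pair_big.
Qed.

Lemma baseline_law_covariate f x A : measurable A ->
  distribution (baseline_law f x) baseline_covariate A = \d_x A.
Proof. by move=> mA; exact: empirical_constant. Qed.

Lemma randomized_law_covariate f x A : measurable A ->
  distribution (randomized_law f x) covariate A = \d_x A.
Proof. by move=> mA; exact: empirical_constant. Qed.

Lemma baseline_law_potential_outcomes f x y :
  baseline_law f x (baseline_potential_outcomes @^-1` [set y]) =
  (#|J|%:R^-1 * \sum_j (f j == y)%:R)%:E.
Proof.
rewrite baseline_lawE; congr (_ * _)%:E; apply: eq_bigr => j _.
by rewrite indicE; congr (nat_of_bool _)%:R; apply/idP/eqP; rewrite inE.
Qed.

Lemma randomized_law_potential_outcomes f x y :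
  randomized_law f x (potential_outcomes @^-1` [set y]) =
  (#|J|%:R^-1 * \sum_j (f j == y)%:R)%:E.
Proof.
rewrite randomized_lawE; congr _%:E.
have indicY (k : D) j : \1_(potential_outcomes @^-1` [set y]) (k, f j, x) =
    (f j == y)%:R :> R.
  by rewrite indicE; congr (nat_of_bool _)%:R; apply/idP/eqP; rewrite inE.
under eq_bigr do under eq_bigr do rewrite indicY.
by rewrite sumr_const card_ord -[X in _ * X]mulr_natl mulrACA mulVf ?mul1r.
Qed.

Lemma randomized_law_joint f x : is_joint_law (randomized_law f x)
  (constant_kernel _ uniform_decision) (baseline_law f x).
Proof.
move=> k y A mA.
rewrite randomized_lawE.
transitivity (\int[distribution (baseline_law f x) baseline_covariate]_(z in A)
   (K.+2%:R^-1 * cond_prob (baseline_law f x) (measurable_baseline_event y)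
      baseline_covariate z)%:E)%E; last first.
  apply: eq_integral => z _.
  by rewrite constant_kernelE uniform_decisionE EFinM.
rewrite (integral_point_covariate (baseline_law_covariate f x))//; last first.
  by apply: measurable_funM => //; exact: measurable_cond_prob.
have -> : cond_prob (baseline_law f x) (measurable_baseline_event y)
    baseline_covariate x = #|J|%:R^-1 * \sum_j (f j == y)%:R.
  apply: EFin_inj; rewrite -(baseline_law_potential_outcomes f x y).
  exact: (cond_prob_point_covariate (baseline_law_covariate f x)).
rewrite diracE -EFinM; congr _%:E.
rewrite [RHS]mulrCA -mulrA; congr (_ * _); rewrite [RHS]mulrCA; congr (_ * _).
rewrite (bigD1 k)//= [X in _ + X]big1 ?addr0; last first.
  move=> k' k'k; apply: big1 => j _; rewrite indicE.
  rewrite (_ : _ \in _ = false)//; apply/negbTE/negP; rewrite inE.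
  by move=> -[[/= /eqP]]; rewrite (negbTE k'k).
rewrite mulr_sumr; apply: eq_bigr => j _.
rewrite indicE -natrM mulnb; congr (nat_of_bool _)%:R.
apply/idP/andP; rewrite !inE => -[].
  by move=> [/= _ ->].
by move=> Ax /eqP fy.
Qed.

Lemma randomized_law_ignorable f x : ignorable_laws (randomized_law f x).
Proof.
exists (baseline_law f x), (constant_kernel _ uniform_decision); split.
  exact: randomized_law_joint.
exists (constant_kernel _ uniform_decision) => k; apply: aeW => // z.
by rewrite constant_kernelE uniform_decisionE lte_fin invr_gt0 ltr0n.
Qed.

(** Only one coordinate of the potential outcome vector is ever observed, so the
    observed law depends on the family f through its one-dimensional marginals.
    Equality of the marginals is phrased with test functions h, the form in
    which sums over the families are compared. *)
Lemma same_observed_randomized_law (f1 f2 : J -> YD) (x : X) :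
  (forall k (h : Y -> R), \sum_j h (f1 j k) = \sum_j h (f2 j k)) ->
  same_observed_law (randomized_law f1 x) (randomized_law f2 x).
Proof.
move=> f12 B mB.
rewrite /distribution /pushforward/= !randomized_lawE; congr (_ * _)%:E.
apply: eq_bigr => k _.
exact: (f12 k (fun c => \1_B (k, c, x))).
Qed.

Lemma policy_prob_dirac (a b : D) (x : X) :
  policy_prob (constant_kernel X (\d_a : pprobability D R)) b x = (a == b)%:R.
Proof.
transitivity (\1_[set b] a : R) => //.
by rewrite indicE; congr (nat_of_bool _)%:R; apply/idP/eqP; rewrite inE.
Qed.

Lemma risk_randomized_law (l : D -> YD -> X -> R) f x a : bounded_loss l ->
  risk (constant_kernel _ (\d_a : pprobability D R)) l (randomized_law f x) =
  #|J|%:R^-1 * \sum_j l a (f j) x.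
Proof.
move=> [ml _]; have covx := randomized_law_covariate f x.
rewrite /risk /Rintegral (integral_point_covariate covx)//; last first.
  do 2 (apply: measurable_sum => ?).
  apply: measurable_funM; last exact: measurable_cond_prob.
  apply: measurable_funM; last exact: measurable_policy_prob.
  apply: (measurableT_comp (g := fun z : X => (_, _, z)) ml).
  exact: measurable_fun_pair.
rewrite diracT mul1e/= /cond_risk (bigD1 a)//= [X in _ + X]big1 ?addr0;
  last first.
  move=> b ba; apply: big1 => y _; rewrite policy_prob_dirac.
  by rewrite eq_sym (negbTE ba) mulr0 mul0r.
have potx y : prob_potential_given (randomized_law f x) y x =
    #|J|%:R^-1 * \sum_j (f j == y)%:R.
  apply: EFin_inj; rewrite -(randomized_law_potential_outcomes f x y).
  exact: (cond_prob_point_covariate covx).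
under eq_bigr => y _.
  rewrite potx policy_prob_dirac eqxx mulr1 mulrCA mulr_sumr.
  over.
rewrite -mulr_sumr exchange_big; congr (_ * _); apply: eq_bigr => j _.
rewrite (bigD1 (f j))//= eqxx mulr1 big1 ?addr0// => y.
by rewrite eq_sym => /negbTE ->; rewrite mulr0.
Qed.

Lemma identifiable_marginals (l : D -> YD -> X -> R) (a : D) (f1 f2 : J -> YD)
    (x : X) : bounded_loss l ->
  (forall pi : R.-pker X ~> D, identifiable (risk pi l)) ->
  (forall k (h : Y -> R), \sum_j h (f1 j k) = \sum_j h (f2 j k)) ->
  \sum_j l a (f1 j) x = \sum_j l a (f2 j) x.
Proof.
move=> hl idl f12.
have := idl (constant_kernel _ (\d_a : pprobability D R)) _ _
  (randomized_law_ignorable f1 x) (randomized_law_ignorable f2 x)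
  (same_observed_randomized_law x f12).
rewrite !risk_randomized_law//; apply: mulfI.
by rewrite invr_eq0 pnatr_eq0 -lt0n; apply/card_gt0P; exists j0.
Qed.

End randomized_law.

(** * Recovering the weights from the loss *)

Section additive_weights.
Context d (X : measurableType d) (R : realType) (K M : nat).
Local Notation D := 'I_K.+2.
Local Notation Y := 'I_M.+2.
Local Notation YD := {ffun D -> Y}.

Definition spike (k : D) (c : Y) : YD :=
  [ffun i => if i == k then c else ord0].

(** The loss at the vector that differs from zero in coordinate k only.  Adding
    these over all k counts the loss at the zero vector K.+1 times too often, so
    each of the K.+2 weights gives back an equal share of the excess. *)
Definition additive_weight (l : D -> YD -> X -> R) (k a : D) (c : Y) (x : X) :=
  l a (spike k c) x - K.+1%:R / K.+2%:R * l a [ffun=> ord0] x.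

Lemma weight_function_additive_weight l k :
  bounded_loss l -> weight_function (additive_weight l k).
Proof.
move=> [ml [C [_ lC]]].
have lC1 a y x : `|l a y x| <= C + 1.
  by apply: (lC (C + 1) _ (a, y, x)) => //; rewrite ltrDl.
have mlh (h : Y -> YD) : measurable_fun setT
    (fun v : D * Y * X => l v.1.1 (h v.1.2) v.2).
  have mh : measurable_fun setT h by move=> _ B _; exact: I.
  have mg : measurable_fun setT
      (fun v : D * Y * X => (v.1.1, h v.1.2, v.2)).
    apply: measurable_fun_pair => //; apply: measurable_fun_pair.
      exact: measurableT_comp.
    exact: (measurableT_comp mh (measurableT_comp _ _)).
  exact: (measurableT_comp ml mg).
split.
  apply: measurable_funB; first exact: mlh.
  by apply: measurable_funM => //; exact: (mlh (fun=> [ffun=> ord0])).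
exists ((C + 1) + (C + 1)); split=> [|c /ltW Cc v _ /=].
  exact: num_real.
apply: le_trans Cc; apply: (le_trans (ler_normB _ _)); apply: lerD => //.
rewrite normrM -[leRHS]mul1r; apply: ler_pM => //.
rewrite ger0_norm ?divr_ge0 ?ler0n// ler_pdivrMr ?ltr0n// mul1r.
by rewrite ler_nat.
Qed.

(** Comparing the family consisting of y and K.+1 zero vectors with the family
    of the vectors that keep a single coordinate of y: in either one, coordinate
    k is y k for one member and zero for all others. *)
Lemma additive_weightE l a y x : bounded_loss l ->
  (forall pi : R.-pker X ~> D, identifiable (risk pi l)) ->
  l a y x = \sum_k additive_weight l k a (y k) x.
Proof.
move=> hl idl.
pose f1 (j : D) : YD := if j == ord0 then y else [ffun=> ord0].
pose f2 (j : D) : YD := spike j (y j).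
have marg k (h : Y -> R) : \sum_j h (f1 j k) = \sum_j h (f2 j k).
  transitivity (h (y k) + h ord0 *+ K.+1).
    rewrite (bigD1 ord0)//= /f1 eqxx; congr (_ + _).
    rewrite (eq_bigr (fun=> h ord0)); last first.
      by move=> j /negbTE ->; rewrite ffunE.
    by rewrite sumr_const cardC1 card_ord.
  rewrite (bigD1 k)//= /f2 ffunE eqxx; congr (_ + _).
  rewrite [RHS](eq_bigr (fun=> h ord0)); last first.
    by move=> j /negbTE jk; rewrite ffunE eq_sym jk.
  by rewrite sumr_const cardC1 card_ord.
have := identifiable_marginals ord0 a x hl idl marg.
rewrite (bigD1 ord0)//= {1}/f1 eqxx.
rewrite (eq_bigr (fun=> l a [ffun=> ord0] x)); last first.
  by move=> j /negbTE j0; rewrite /f1 j0.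
rewrite sumr_const cardC1 card_ord /= /f2 => lE.
rewrite /additive_weight sumrB -lE sumr_const card_ord.
rewrite -[X in _ - X]mulr_natl mulrA mulrCA mulfV ?mulr1 ?pnatr_eq0//.
by rewrite mulr_natl addrK.
Qed.

End additive_weights.

Theorem corollary2 (d : measure_display) (X : measurableType d) (R : realType)
    (K M : nat) (l : 'I_K.+2 -> {ffun 'I_K.+2 -> 'I_M.+2} -> X -> R)
    (hl : bounded_loss l) :
  ((forall pi : R.-pker X ~> 'I_K.+2, identifiable (risk pi l)) <->
   (exists w : 'I_K.+2 -> 'I_K.+2 -> 'I_M.+2 -> X -> R,
      (forall k, weight_function (w k)) /\
      (forall (a : 'I_K.+2) (y : {ffun 'I_K.+2 -> 'I_M.+2}) (x : X),
         l a y x = \sum_(k < K.+2) w k a (y k) x)))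
  /\
  (forall w : 'I_K.+2 -> 'I_K.+2 -> 'I_M.+2 -> X -> R,
     (forall k, weight_function (w k)) ->
     (forall (a : 'I_K.+2) (y : {ffun 'I_K.+2 -> 'I_M.+2}) (x : X),
        l a y x = \sum_(k < K.+2) w k a (y k) x) ->
     forall (pi : R.-pker X ~> 'I_K.+2)
       (P : probability ('I_K.+2 * {ffun 'I_K.+2 -> 'I_M.+2} * X)%type R),
       ignorable_laws P ->
       risk pi l P =
       \sum_(a < K.+2) \sum_(k < K.+2) \sum_(y < M.+2)
         \int[distribution P covariate]_x
           (w k a y x * policy_prob pi a x * prob_outcome_given P y k x)).
Proof.
split; last by move=> w hw lw pi P hP; exact: risk_additive.
split=> [idl|[w [hw lw]] pi]; last exact: (identifiable_additive pi hw lw).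
exists (additive_weight l); split=> [k|a y x].
  exact: weight_function_additive_weight.
exact: additive_weightE.
Qed.
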